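(* Fix a checkpoint $\bar\theta$, a token $k$ and a spatial grid $\mathcal S$. For a draw $Z\sim P_0$ let $M_{\bar\theta}(Z,s)$, $s\in\mathcal S$, be the normalized residual-contrast map and $\bar A^+_{k,\bar\theta}(s;Z)$, $s\in\mathcal S$, the winner-side attention map of token $k$, both defined in the context. Assume: (F1) $\bar\theta$ and all attribution settings are fixed in advance, and $Z_1,Z_2,\dots$ are independent draws from $P_0$. (F2) The random variables $$X_{i,k}=\sum_{s\in\mathcal S}\bar A^+_{k,\bar\theta}(s;Z_i)\,M_{\bar\theta}(Z_i,s),\qquad Y_{i,k}=\sum_{s\in\mathcal S}\bar A^+_{k,\bar\theta}(s;Z_i)$$ have finite first moments. (F3) $\mathcal S$ is finite and fixed. (F4) $0\le\bar A^+_{k,\bar\theta}(s;Z)\le1$ for all $s\in\mathcal S$, and $b_k(Z):=\sum_{s\in\mathcal S}\bar A^+_{k,\bar\theta}(s;Z)$ satisfies $0<\mathbb E_{Z\sim P_0}[b_k(Z)]<\infty$. Then the self-normalized token statistic $$\widehat w^{\mathrm{data}}_{k,n}=\frac{\sum_{i=1}^nX_{i,k}}{\sum_{i=1}^nY_{i,k}}$$ converges in probability, as $n\to\infty$, to $$\rho_k^{\mathrm{disc}}=\frac{\mathbb E_{Z\sim P_0}\bigl[\sum_{s\in\mathcal S}\bar A^+_{k,\bar\theta}(s;Z)\,M_{\bar\theta}(Z,s)\bigr]}{\mathbb E_{Z\sim P_0}\bigl[\sum_{s\in\mathcal S}\bar A^+_{k,\bar\theta}(s;Z)\bigr]}.$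$
   Context: A draw $Z$ from the distribution $P_0$ consists of a preference triple (prompt $c$, preferred image $x^+$, dispreferred image $x^-$) and diffusion noise. For each $i$ in a finite set $\mathcal A$ of anchor timesteps $\tau_i$, both images' latent encodings are noised with the same noise $\varepsilon_i$, giving $z^{\pm}_{\tau_i}$; a frozen denoiser produces predictions $\widehat\varepsilon_i^{\pm}(q,s)$ at channel $q\in\{1,\dots,C\}$ and site $s\in\mathcal S$. With fixed nonnegative weights $\omega_i$, $$R_i^\pm(q,s)=\omega_i\bigl(\varepsilon_i(q,s)-\widehat\varepsilon_i^\pm(q,s)\bigr)^2,\quad D_i(s)=\frac1C\sum_{q=1}^C\bigl|R_i^+(q,s)-R_i^-(q,s)\bigr|,\quad d_s(Z,s)=\frac1{|\mathcal A|}\sum_{i\in\mathcal A}D_i(s).$$ The residual-contrast map is $M_{\bar\theta}(Z,s)=\operatorname{Norm}_1[d_s(Z,\cdot)](s)=d_s(Z,s)/\sum_{s'\in\mathcal S}d_s(Z,s')$, so it is nonnegative and sums to one over $\mathcal S$ (it is assumed that the normalization is well defined). The map $\bar A^+_{k,\bar\theta}(s;Z)$ is the nonnegative cross-attention mass that token $k$ receives at site $s$ on the preferred branch (averaged over heads, layers and anchors and resized to $\mathcal S$). Both are measurable functions of $Z$ for each $s$; the result uses no other properties of them than those stated. When the denominator of $\widehat w^{\mathrm{data}}_{k,n}$ vanishes, the ratio may be assigned an arbitrary fixed value. *)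

(* Defs.v *)
From HB Require Import structures.
From mathcomp Require Import all_boot all_order all_algebra.
From mathcomp Require Import all_classical all_reals all_analysis.
Set Implicit Arguments.
Unset Strict Implicit.
Unset Printing Implicit Defensive.
Import Order.TTheory GRing.Theory Num.Theory.
Import numFieldNormedType.Exports.
Local Open Scope classical_set_scope.
Local Open Scope ring_scope.

(* Values at (channel, site), with C channels and site grid S. *)
Definition field_on (R : realType) (C : nat) (S : finType) := 'I_C -> S -> R.

(* T is the type of draws.  The draw is accessed through its components: the
   preference triple and one noise field per anchor, shared by both images.
   The encoder, the forward noising rule, the denoiser, the raw attention and
   the resizing are arbitrary fixed maps. *)
Record attribution_settings (R : realType) (T : Type) (S : finType) :=
  AttributionSettings {
  prompt_type : Type;
  image_type : Type;
  checkpoint_type : Type;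
  token_type : Type;
  time_type : Type;
  anchor : finType;
  nb_channels : nat;
  prompt : T -> prompt_type;
  preferred : T -> image_type;
  dispreferred : T -> image_type;
  noise : T -> anchor -> field_on R nb_channels S;
  timestep : anchor -> time_type;
  weight : anchor -> R;
  weight_ge0 : forall i, 0 <= weight i;
  encode : image_type -> field_on R nb_channels S;
  add_noise : time_type -> field_on R nb_channels S ->
    field_on R nb_channels S -> field_on R nb_channels S;
  denoise : checkpoint_type -> time_type -> field_on R nb_channels S ->
    prompt_type -> field_on R nb_channels S;
  head : finType;
  layer : finType;
  layer_grid : layer -> Type;
  raw_attention : checkpoint_type -> time_type -> field_on R nb_channels S ->
    prompt_type -> token_type -> head -> forall l : layer, layer_grid l -> R;
  resize : forall l : layer, (layer_grid l -> R) -> S -> R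
}.

Section maps.
Context {R : realType} {T : Type} {S : finType}.
Variables (cfg : attribution_settings R T S) (theta : checkpoint_type cfg).

Definition noised_latent (x : image_type cfg) (z : T) (i : anchor cfg) :
    field_on R (nb_channels cfg) S :=
  add_noise (timestep i) (encode x) (noise z i).

Definition prediction (x : image_type cfg) (z : T) (i : anchor cfg) :
    field_on R (nb_channels cfg) S :=
  denoise theta (timestep i) (noised_latent x z i) (prompt cfg z).

Definition residual (x : image_type cfg) (z : T) (i : anchor cfg)
    (q : 'I_(nb_channels cfg)) (s : S) : R :=
  weight i * (noise z i q s - prediction x z i q s) ^+ 2.

Definition anchor_contrast (z : T) (i : anchor cfg) (s : S) : R :=
  (nb_channels cfg)%:R^-1 *
  \sum_(q < nb_channels cfg)
    `|residual (preferred cfg z) z i q s - residual (dispreferred cfg z) z i q s|.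

Definition contrast (z : T) (s : S) : R :=
  #|anchor cfg|%:R^-1 * \sum_(i : anchor cfg) anchor_contrast z i s.

(* Meaningful only where the total contrast is nonzero; it is 0 otherwise. *)
Definition residual_contrast_map (z : T) (s : S) : R :=
  contrast z s / \sum_(s' : S) contrast z s'.

(* Layers may have different resolutions, so resizing precedes averaging. *)
Definition winner_attention (k : token_type cfg) (z : T) (s : S) : R :=
  (#|head cfg| * #|layer cfg| * #|anchor cfg|)%:R^-1 *
  \sum_(h : head cfg) \sum_(l : layer cfg) \sum_(i : anchor cfg)
    resize (raw_attention theta (timestep i)
              (noised_latent (preferred cfg z) z i) (prompt cfg z) k h (l := l))
      s.

Definition weighted_mass (k : token_type cfg) (z : T) : R :=
  \sum_(s : S) winner_attention k z s * residual_contrast_map z s.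

Definition attention_mass (k : token_type cfg) (z : T) : R :=
  \sum_(s : S) winner_attention k z s.

(* v is the value given to the ratio when its denominator vanishes. *)
Definition token_statistic (v : R) (k : token_type cfg) (Z : nat -> T)
    (n : nat) : R :=
  let den := \sum_(i < n) attention_mass k (Z i) in
  if den == 0 then v else (\sum_(i < n) weighted_mass k (Z i)) / den.

End maps.

Definition mutually_independent d d' (Omega : measurableType d)
    (T : measurableType d') (R : realType) (P : probability Omega R)
    (Z : nat -> Omega -> T) : Prop :=
  forall (J : seq nat) (B : nat -> set T), uniq J ->
    (forall j, measurable (B j)) ->
    P (\bigcap_(j in [set` J]) (Z j @^-1` B j)) =
    (\prod_(j <- J) P (Z j @^-1` B j))%E.

Definition converges_in_probability d (Omega : measurableType d)
    (R : realType) (P : probability Omega R) (W : nat -> Omega -> R) (l : R) :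
    Prop :=
  forall e : R, 0 < e ->
    P [set w | e < `|W n w - l|] @[n --> \oo] --> 0%E.

Definition disc_ratio d (T : measurableType d) (R : realType) (S : finType)
    (P0 : probability T R) (cfg : attribution_settings R T S)
    (theta : checkpoint_type cfg) (k : token_type cfg) : R :=
  fine 'E_P0[weighted_mass theta k]%E / fine 'E_P0[attention_mass theta k]%E.

(* Main.v *)
(* Since 0 <= A <= 1 and 0 <= M <= 1, the numerator and the denominator are sums
   of bounded i.i.d. variables X_i and Y_i, so Chebyshev's inequality suffices.
   With m = E[Y] > 0 and rho = E[X] / m, the ratio can be further than e from rho
   only if the sum of the centered X_i - rho Y_i reaches e (m / 2) n, or that of
   Y_i - m reaches (m / 2) n; both events have probability O(1/n). The second
   one also contains the event that the denominator vanishes. *)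
Require Import Defs.
From HB Require Import structures.
From mathcomp Require Import all_boot all_order all_algebra.
From mathcomp Require Import all_classical all_reals all_analysis.
From mathcomp Require Import measurable_realfun ring lra.
Set Implicit Arguments.
Unset Strict Implicit.
Unset Printing Implicit Defensive.
Import Order.TTheory GRing.Theory Num.Theory.
Import numFieldNormedType.Exports.
Local Open Scope classical_set_scope.
Local Open Scope ring_scope.

(** * Expectations of bounded functions of independent draws *)

Lemma bounded_integrable d (T : measurableType d) (R : realType)
    (P : probability T R) (f : T -> R) (K : R) :
  measurable_fun [set: T] f -> (forall x, `|f x| <= K) ->
  P.-integrable [set: T] (EFin \o f).
Proof.
move=> mf fK; apply: measurable_bounded_integrable => //.
  by rewrite -ge0_fin_numE// fin_num_measure.
exists K; split; first exact: num_real.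
by move=> M KM x _; exact: le_trans (fK x) (ltW KM).
Qed.

(** Independence makes the joint law of [X] and [Y] the product of their laws, and Fubini's theorem
    then splits the integral of [f x * g y]. Boundedness supplies every integrability condition. *)
Lemma expectation_indep_mul d d' (Omega : measurableType d)
    (T : measurableType d') (R : realType) (P : probability Omega R)
    (X Y : {RV P >-> T}) (f g : T -> R) (K L : R) :
  (forall A B, measurable A -> measurable B ->
    P (X @^-1` A `&` Y @^-1` B) = (P (X @^-1` A) * P (Y @^-1` B))%E) ->
  measurable_fun [set: T] f -> (forall x, `|f x| <= K) ->
  measurable_fun [set: T] g -> (forall x, `|g x| <= L) ->
  ('E_P[fun w => (f (X w) * g (Y w))%R] = 'E_P[f \o X] * 'E_P[g \o Y])%E.
Proof.
move=> indep mf fK mg gL.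
have mXY : measurable_fun [set: Omega] (fun w => (X w, Y w)).
  by apply/measurable_fun_pairP; split; exact: measurable_funP.
pose XY : {RV P >-> (T * T)%type} := HB.pack (fun w => (X w, Y w))
  (isMeasurableFun.Build _ _ _ _ _ mXY).
pose h := fun z : T * T => f z.1 * g z.2.
have mh : measurable_fun [set: T * T] h.
  by apply: measurable_funM; apply: measurableT_comp.
have hKL z : `|h z| <= K * L by rewrite normrM ler_pM.
(* Measurable rectangles determine the product measure, and on them the claim is the independence
   hypothesis. *)
have prodE A : measurable A ->
    (distribution P X \x distribution P Y)%E A = distribution P XY A.
  apply: product_measure_unique => B C mB mC.
  by rewrite /= /distribution /pushforward/= -indep.
have iprod : (distribution P X \x distribution P Y)%E.-integrable [set: T * T]
    (EFin \o h).
  exact: bounded_integrable mh hKL.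
have iX : (distribution P X).-integrable [set: T] (EFin \o f).
  exact: bounded_integrable mf fK.
have iY : (distribution P Y).-integrable [set: T] (EFin \o g).
  exact: bounded_integrable mg gL.
rewrite unlock.
have -> : (\int[P]_w (f (X w) * g (Y w))%:E =
    \int[(distribution P X \x distribution P Y)%E]_z (h z)%:E)%E.
  rewrite (eq_measure_integral (distribution P XY)); last first.
    by move=> A mA _; exact: prodE.
  rewrite integral_pushforward//; first exact/measurable_EFinP.
  apply: (@bounded_integrable _ _ _ P (h \o XY) (K * L)) => [|w].
    exact: measurableT_comp.
  exact: hKL.
rewrite -(integral12_prod_meas1 iprod).
have fin_g : (\int[distribution P Y]_y (g y)%:E)%E \is a fin_num.
  exact: integrable_fin_num.
(* The inner integral equals [f x] times the integral of [g]. The latter is finite, so writing it as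
   a real constant lets it leave the outer integral as well. *)
under eq_integral => x _.
  rewrite /fubini_F /h /=.
  under eq_integral => y _ do rewrite EFinM.
  rewrite integralZl// -(fineK fin_g) muleC.
  over.
rewrite /= integralZl// (fineK fin_g) muleC.
by congr (_ * _)%E; rewrite integral_pushforward//;
  (exact/measurable_EFinP ||
   (apply: bounded_integrable => //; exact: measurableT_comp)).
Qed.

(** A change of variables moves the integral to the law of [X], which agrees with [P0] on measurable
    sets. *)
Lemma expectation_comp d d' (Omega : measurableType d) (T : measurableType d')
    (R : realType) (P : probability Omega R) (P0 : probability T R)
    (X : {RV P >-> T}) (f : T -> R) (K : R) :
  (forall B, measurable B -> distribution P X B = P0 B) ->
  measurable_fun [set: T] f -> (forall x, `|f x| <= K) ->
  ('E_P[f \o X] = 'E_P0[f])%E.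
Proof.
move=> law mf fK; rewrite unlock [RHS](eq_measure_integral (distribution P X)).
  by rewrite integral_pushforward//;
    [exact/measurable_EFinP |
     apply: bounded_integrable => //; exact: measurableT_comp].
by move=> A mA _; exact/esym/law.
Qed.

Lemma mutually_independent_pair d d' (Omega : measurableType d)
    (T : measurableType d') (R : realType) (P : probability Omega R)
    (Z : nat -> Omega -> T) (i j : nat) (A B : set T) :
  mutually_independent P Z -> i != j -> measurable A -> measurable B ->
  P (Z i @^-1` A `&` Z j @^-1` B) = (P (Z i @^-1` A) * P (Z j @^-1` B))%E.
Proof.
move=> indep ij mA mB.
(* The test sets are [A] at index [i] and [B] at every other index; [i != j] makes the value at [j]
   equal to [B]. *)
have := indep [:: i; j] (fun l => if l == i then A else B).
rewrite /= inE ij !big_cons big_nil eqxx eq_sym (negbTE ij) mule1 => <- //.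
  congr (P _); apply/seteqP; split => w /=.
    move=> [Aw Bw] l; rewrite /= !inE => /orP[]/eqP ->; rewrite ?eqxx//.
    by rewrite eq_sym (negbTE ij).
  move=> ABw; split; first by have := ABw i; rewrite /= !inE !eqxx; exact.
  by have := ABw j; rewrite /= !inE eqxx orbT eq_sym (negbTE ij); exact.
by move=> l; case: ifP.
Qed.

(** * Chebyshev bound for sums of centered i.i.d. variables *)

(** Expanding the squared sum leaves [n] diagonal terms of mean at most [K ^+ 2]; the cross terms
    have mean zero by independence and centering. Markov's inequality for the square concludes. *)
Lemma iid_sum_deviation d d' (Omega : measurableType d) (T : measurableType d')
    (R : realType) (P : probability Omega R) (P0 : probability T R)
    (Z : nat -> {RV P >-> T}) (f : T -> R) (K t : R) (n : nat) :
  (forall i B, measurable B -> distribution P (Z i) B = P0 B) ->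
  mutually_independent P (fun i => Z i : Omega -> T) ->
  measurable_fun [set: T] f -> (forall x, `|f x| <= K) ->
  ('E_P0[f] = 0)%E -> 0 < t ->
  (P [set w | (t <= `|\sum_(i < n) f (Z i w)|)%R]
     <= (n%:R * K ^+ 2 / t ^+ 2)%:E)%E.
Proof.
move=> law indep mf fK f0 t0.
pose a (i : 'I_n) w := f (Z i w).
have ma i : measurable_fun [set: Omega] (a i) by exact: measurableT_comp.
have aa_int i j : P.-integrable [set: Omega] (EFin \o (fun w => a i w * a j w)).
  apply: (@bounded_integrable _ _ _ P _ (K * K)); first exact: measurable_funM.
  by move=> w; rewrite normrM ler_pM//; exact: fK.
have aaE i j :
    (\int[P]_w (a i w * a j w)%:E <= (if i == j then K ^+ 2 else 0)%:E)%E.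
  have [->|ij] := eqVneq i j.
    apply: (@le_trans _ _ (\int[P]_w (cst (K ^+ 2)%:E w))%E); last first.
      by rewrite integral_cst//= probability_setT mule1.
    apply: le_integral => //.
    - exact: aa_int.
    - exact: finite_measure_integrable_cst.
    - move=> w _; rewrite lee_fin -expr2 -real_normK ?num_real//.
      by rewrite lerXn2r ?nnegrE// (le_trans _ (fK (Z j w))).
  have := @expectation_indep_mul _ _ _ _ _ P (Z i) (Z j) f f K K _ mf fK mf fK.
  rewrite (expectation_comp (law i) mf fK) f0 mul0e unlock => -> //.
  by move=> A B mA mB; exact: (mutually_independent_pair indep).
have mS : measurable_fun [set: Omega] (fun w => \sum_(i < n) a i w).
  exact: measurable_sum.
have sqE w : ((\sum_(i < n) a i w) ^+ 2)%:E =
    (\sum_(i < n) \sum_(j < n) (a i w * a j w)%:E)%E.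
  rewrite expr2 big_distrlr/= -sumEFin; apply: eq_bigr => i _.
  by rewrite -sumEFin.
have markov_S : ((t ^+ 2)%:E * P [set w | (t <= `|\sum_(i < n) f (Z i w)|)%R] <=
    \int[P]_w ((\sum_(i < n) a i w) ^+ 2)%:E)%E.
  (* The event is restated for the squared sum, the form to which Markov's inequality applies. *)
  have -> : [set w | (t <= `|\sum_(i < n) f (Z i w)|)%R] =
      [set w | ((t ^+ 2)%:E <= `|((\sum_(i < n) a i w) ^+ 2)%:E|)%E].
    apply/seteqP; split=> w /=; rewrite lee_fin normrX;
      by rewrite ler_pXn2r ?nnegrE// ltW.
  have /(_ (t ^+ 2)) := @le_integral_abse _ Omega R P setT measurableT
    (fun w => ((\sum_(i < n) a i w) ^+ 2)%:E).
  rewrite setTI; under eq_integral do rewrite abse_EFin ger0_norm ?sqr_ge0//.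
  by apply; [exact/measurable_EFinP/measurable_funX|exact: exprn_gt0].
have int_S : (\int[P]_w ((\sum_(i < n) a i w) ^+ 2)%:E <= (n%:R * K ^+ 2)%:E)%E.
  under eq_integral do rewrite sqE.
  rewrite integral_sum//; last first.
    by move=> i; apply: integrable_sum => [|j _]; [by []|exact: aa_int].
  apply: (@le_trans _ _
      (\sum_(i < n) \sum_(j < n) (if i == j then K ^+ 2 else 0)%:E)%E).
    apply: lee_sum => i _.
    rewrite integral_sum//; last by move=> j; exact: aa_int.
    by apply: lee_sum => j _; exact: aaE.
  under eq_bigr => i _.
    rewrite sumEFin -big_mkcond/= (big_pred1 i); last first.
      by move=> j; rewrite /= eq_sym.
    over.
  by rewrite sumEFin sumr_const card_ord mulr_natl.
rewrite EFinM lee_pdivlMr ?exprn_gt0// muleC.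
exact: le_trans markov_S int_S.
Qed.

(** * Deviation of a ratio from its target *)

(** Stated as an equality of booleans so that it serves both the deviation estimate and the
    rewriting of the deviation event into a division-free form. *)
Lemma ltr_norm_ratioB (R : realFieldType) (num den rho e : R) : 0 < den ->
  (e < `|num / den - rho|) = (e * den < `|num - rho * den|).
Proof.
move=> den_gt0; rewrite -[rho in LHS](mulfK (lt0r_neq0 den_gt0)) -mulrBl.
by rewrite normrM normfV (gtr0_norm den_gt0) ltr_pdivlMr.
Qed.

(** Closeness of [den] to [m * N] forces [den] above [m / 2 * N]. The error of the numerator is then
    below [e * den], and dividing by [den] gives [e]. *)
Lemma ratio_deviation (R : realFieldType) (num den N rho m e v : R) :
  0 < e -> `|num - rho * den| < e * (m / 2) * N -> `|den - m * N| < m / 2 * N ->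
  `|(if den == 0 then v else num / den) - rho| <= e.
Proof.
move=> e0 num_close den_close.
have den_large : m / 2 * N < den by move: den_close; rewrite ltr_norml; lra.
have den_gt0 : 0 < den.
  (* [m / 2 * N] is nonnegative because it exceeds an absolute value. *)
  by rewrite (le_lt_trans _ den_large)// (le_trans _ (ltW den_close)).
rewrite gt_eqF// leNgt ltr_norm_ratioB// -leNgt (le_trans (ltW num_close))//.
by rewrite -mulrA ler_pM2l// ltW.
Qed.

(** * Convergence in probability of ratio estimators *)

Lemma ratio_estimator_cvg d d' (Omega : measurableType d) (T : measurableType d')
    (R : realType) (P : probability Omega R) (P0 : probability T R)
    (Z : nat -> {RV P >-> T}) (f h : T -> R) (K L v : R) :
  (forall i B, measurable B -> distribution P (Z i) B = P0 B) ->
  mutually_independent P (fun i => Z i : Omega -> T) ->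
  measurable_fun [set: T] f -> (forall x, `|f x| <= K) ->
  measurable_fun [set: T] h -> (forall x, `|h x| <= L) ->
  (forall x, 0 <= h x) -> (0 < 'E_P0[h])%E ->
  converges_in_probability P
    (fun n w => let den := \sum_(i < n) h (Z i w) in
      if den == 0 then v else (\sum_(i < n) f (Z i w)) / den)
    (fine 'E_P0[f]%E / fine 'E_P0[h]%E).
Proof.
move=> law indep mf fK mh hL h0 Eh0.
have if_ : P0.-integrable [set: T] (EFin \o f).
  exact: bounded_integrable mf fK.
have ih_ : P0.-integrable [set: T] (EFin \o h).
  exact: bounded_integrable mh hL.
have Ef_fin : ('E_P0[f])%E \is a fin_num by rewrite unlock integrable_fin_num.
have Eh_fin : ('E_P0[h])%E \is a fin_num by rewrite unlock integrable_fin_num.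
set m := fine 'E_P0[h]%E; set rho := fine 'E_P0[f]%E / m.
have m0 : 0 < m by rewrite fine_gt0// Eh0 ltey_eq Eh_fin.
(* The choices of [rho] and [m] give both functions mean zero. Over [n] draws, [u] sums to the
   numerator minus [rho] times the denominator, and [c] to the denominator minus [m * n]. *)
pose u x := f x - rho * h x; pose c x := h x - m.
have mu_ : measurable_fun [set: T] u.
  by apply: measurable_funB => //; exact: measurable_funM.
have mc : measurable_fun [set: T] c by exact: measurable_funB.
have u_bd x : `|u x| <= K + `|rho| * L.
  by rewrite (le_trans (ler_normB _ _))// normrM lerD// ler_wpM2l.
have c_bd x : `|c x| <= L + m.
  by rewrite (le_trans (ler_normB _ _))// (gtr0_norm m0) lerD2r.
have Eu : ('E_P0[u] = 0)%E.
  rewrite unlock.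
  under eq_integral do rewrite /u EFinB EFinM.
  rewrite integralB//; last exact: integrableZl.
  rewrite integralZl//.
  have := Ef_fin; have := Eh_fin; rewrite unlock => Eh_fin' Ef_fin'.
  rewrite -(fineK Ef_fin') -(fineK Eh_fin') -EFinM -EFinB.
  have -> : fine (\int[P0]_x (h x)%:E)%E = m by rewrite /m unlock.
  by rewrite divfK ?gt_eqF// unlock subrr.
have Ec : ('E_P0[c] = 0)%E.
  rewrite unlock.
  under eq_integral do rewrite /c EFinB.
  rewrite integralB//; last exact: finite_measure_integrable_cst.
  rewrite integral_cst//= probability_setT mule1 /m unlock.
  by move: Eh_fin; rewrite unlock => Eh_fin'; rewrite fineK// subee.
move=> e e0.
(* Sum of the two Chebyshev constants: the thresholds grow linearly in the number of draws, so each
   bound is its summand of [C] divided by that number. *)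
pose C := (K + `|rho| * L) ^+ 2 / (e * (m / 2)) ^+ 2 +
  (L + m) ^+ 2 / (m / 2) ^+ 2.
have mhS n : measurable_fun [set: Omega] (fun w => \sum_(i < n) h (Z i w)).
  by apply: measurable_sum => i; exact: measurableT_comp.
have mfS n : measurable_fun [set: Omega] (fun w => \sum_(i < n) f (Z i w)).
  by apply: measurable_sum => i; exact: measurableT_comp.
have mdev n (g : T -> R) (t : R) : measurable_fun [set: T] g ->
    measurable [set w | t <= `|\sum_(i < n) g (Z i w)|].
  move=> mg; rewrite -[X in measurable X]setTI.
  have mS : measurable_fun [set: Omega] (fun w => `|\sum_(i < n) g (Z i w)|).
    apply: measurableT_comp => //.
    by apply: measurable_sum => i; exact: measurableT_comp.
  have := measurable_fun_ler (@measurable_cst _ _ _ _ setT t) mS.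
  by move=> /(_ measurableT [set true]); exact.
pose W n w := let den := \sum_(i < n) h (Z i w) in
  if den == 0 then v else (\sum_(i < n) f (Z i w)) / den.
(* The ratio is cross-multiplied by its nonnegative denominator, so that no
   measurability of the inverse is needed. *)
have WE n : [set w | e < `|W n w - rho|] =
    (fun w => if \sum_(i < n) h (Z i w) == 0 then e < `|v - rho| else
      e * (\sum_(i < n) h (Z i w)) <
      `|\sum_(i < n) f (Z i w) - rho * \sum_(i < n) h (Z i w)|) @^-1` [set true].
  apply/seteqP; split=> w; rewrite /= /W; case: eqVneq => // den_neq0;
    by rewrite ltr_norm_ratioB// lt0r den_neq0 sumr_ge0.
have mW n : measurable [set w | e < `|W n w - rho|].
  rewrite WE -[X in measurable X]setTI; apply: measurable_fun_ifT => //.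
    exact: measurable_fun_eqr.
  apply: measurable_fun_ltr; first exact: measurable_funM.
  apply: measurableT_comp => //; apply: measurable_funB => //.
  exact: measurable_funM.
(* The sample size is [n.+1], which is positive and matches [harmonic n], the inverse of [n.+1]. *)
have bound n : (P [set w | (e < `|W n.+1 w - rho|)%R] <= (C * harmonic n)%:E)%E.
  have Nn_gt0 : 0 < n.+1%:R :> R by rewrite ltr0n.
  pose t := e * (m / 2) * n.+1%:R; pose s := m / 2 * n.+1%:R.
  have t0 : 0 < t by rewrite !mulr_gt0.
  have s0 : 0 < s by rewrite !mulr_gt0.
  pose A := [set w | t <= `|\sum_(i < n.+1) u (Z i w)|].
  pose B := [set w | s <= `|\sum_(i < n.+1) c (Z i w)|].
  have sub : [set w | e < `|W n.+1 w - rho|] `<=` A `|` B.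
    move=> w /= W_far; apply: contrapT => /not_orP[/negP + /negP].
    rewrite -!ltNge => A_close B_close; move: W_far; apply/negP; rewrite -leNgt.
    apply: (@ratio_deviation _ _ _ n.+1%:R _ m) => //.
      by move: A_close; rewrite sumrB -mulr_sumr.
    by move: B_close; rewrite sumrB sumr_const card_ord mulr_natr.
  apply: (le_trans (le_measure _ _ _ sub)); rewrite ?inE//.
    by apply: measurableU; exact: mdev.
  apply: (le_trans (measureU2 _ _ _)); [exact: mdev|exact: mdev|].
  apply: le_trans (leeD (iid_sum_deviation n.+1 law indep mu_ u_bd Eu t0)
    (iid_sum_deviation n.+1 law indep mc c_bd Ec s0)) _.
  rewrite -EFinD lee_fin le_eqVlt; apply/orP; left; apply/eqP.
  by rewrite /C /t /s /harmonic/=; field; rewrite !gt_eqF.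
(* Dropping the empty sample does not change the limit; the shifted sequence is squeezed between 0
   and [C * harmonic n]. *)
rewrite -cvg_shiftS.
have C_cvg : (C * harmonic n)%:E @[n --> \oo] --> 0%E.
  apply/cvg_EFin; first by near=> n.
  by rewrite -(mulr0 C); apply: cvgMl_tmp => //; exact: cvg_harmonic.
apply: (squeeze_cvge _ (@cvg_cst _ _ _ _ _) C_cvg).
by near=> n; rewrite measure_ge0 bound.
Unshelve. all: end_near. Qed.

(** * Range of the residual-contrast map *)

Lemma contrast_ge0 (R : realType) (T : Type) (S : finType)
    (cfg : attribution_settings R T S) (theta : checkpoint_type cfg) z s :
  0 <= contrast theta z s.
Proof.
rewrite mulr_ge0 ?invr_ge0// sumr_ge0// => i _.
by rewrite mulr_ge0 ?invr_ge0// sumr_ge0.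
Qed.

Lemma residual_contrast_map_itv (R : realType) (T : Type) (S : finType)
    (cfg : attribution_settings R T S) (theta : checkpoint_type cfg) z s :
  0 <= residual_contrast_map theta z s <= 1.
Proof.
rewrite /residual_contrast_map.
have tot_ge0 : 0 <= \sum_(s' : S) contrast theta z s'.
  by apply: sumr_ge0 => s' _; exact: contrast_ge0.
rewrite divr_ge0 ?contrast_ge0//=.
(* Where the total vanishes, the inverse of 0 is 0 and so is the map; elsewhere one nonnegative
   summand is at most the total. *)
have [->|tot_neq0] := eqVneq (\sum_(s' : S) contrast theta z s') 0.
  by rewrite invr0 mulr0.
rewrite ler_pdivrMr ?lt0r ?tot_neq0// mul1r (bigD1 s)//= lerDl.
by apply: sumr_ge0 => s' _; exact: contrast_ge0.
Qed.

(** * Consistency of the token statistic *)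

Theorem proposition4 (R : realType) (dT dO : measure_display)
    (T : measurableType dT) (P0 : probability T R)
    (Omega : measurableType dO) (P : probability Omega R)
    (S : finType) (cfg : attribution_settings R T S)
    (theta : checkpoint_type cfg) (k : token_type cfg)
    (Z : nat -> {RV P >-> T}) (v : R)
    (meas_M : forall s : S,
       measurable_fun [set: T] (fun z => residual_contrast_map theta z s))
    (meas_A : forall s : S,
       measurable_fun [set: T] (fun z => winner_attention theta k z s))
    (normalizable : {ae P0, forall z, \sum_(s : S) contrast theta z s != 0})
    (F1_law : forall (i : nat) (B : set T), measurable B ->
       distribution P (Z i) B = P0 B)
    (F1_indep : mutually_independent P (fun i => Z i : Omega -> T))
    (F2_X : forall i : nat, P.-integrable [set: Omega]
       (fun w => (weighted_mass theta k (Z i w))%:E))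
    (F2_Y : forall i : nat, P.-integrable [set: Omega]
       (fun w => (attention_mass theta k (Z i w))%:E))
    (F4_range : forall (z : T) (s : S), 0 <= winner_attention theta k z s <= 1)
    (F4_mass : (0 < 'E_P0[attention_mass theta k] < +oo)%E) :
  converges_in_probability P
    (fun n w => token_statistic theta v k (fun i => Z i w) n)
    (disc_ratio P0 theta k).
Proof.
(* The number of sites bounds both masses, since the attention and its product with the contrast map
   take values between 0 and 1. *)
have sum_bd (F : S -> R) : (forall s, 0 <= F s <= 1) -> `|\sum_s F s| <= #|S|%:R.
  move=> F01; rewrite ger0_norm; last first.
    by apply: sumr_ge0 => s _; have /andP[] := F01 s.
  by rewrite -sumr_const ler_sum// => s _; have /andP[] := F01 s.
apply: (@ratio_estimator_cvg _ _ _ _ _ _ P0 Z _ _ #|S|%:R #|S|%:R).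
- exact: F1_law.
- exact: F1_indep.
- by apply: measurable_sum => s; exact: measurable_funM.
- move=> z; apply: sum_bd => s; have /andP[A0 A1] := F4_range z s.
  have /andP[M0 M1] := residual_contrast_map_itv theta z s.
  by rewrite mulr_ge0//= mulr_ile1.
- exact: measurable_sum.
- by move=> z; exact: sum_bd (F4_range z).
- by move=> z; apply: sumr_ge0 => s _; have /andP[] := F4_range z s.
- by have /andP[] := F4_mass.
Qed.
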